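(* Let $(V,\rho,\alpha_V,\beta_V)$ be a representation of a regular multiplicative BiHom-Jordan superalgebra $(\mathfrak J,\cdot,\alpha,\beta)$ and let $(sV,\rho^s,\alpha_V^s,\beta_V^s)$ be its parity reverse representation. Then, for each $i\in\mathbb Z_2$, there exists a one-to-one correspondence between $\mathcal O_i(\mathfrak J;V,\rho,\alpha_V,\beta_V)$ and $\mathcal O_{i+\bar1}(\mathfrak J;sV,\rho^s,\alpha_V^s,\beta_V^s)$.
   Context: Vector spaces are over an algebraically closed field $\mathbb K$ of characteristic $0$. For a $\mathbb Z_2$-graded vector space $W$, $\mathcal H(W)$ denotes the set of homogeneous elements and $|x|$ the parity of $x$; even (bi)linear maps preserve the $\mathbb Z_2$-degree; $|T|$ is the parity of a homogeneous linear map $T$. For $V=V_{\bar0}\oplus V_{\bar1}$, $sV$ is the $\mathbb Z_2$-graded space with $(sV)_{\bar0}=V_{\bar1}$, $(sV)_{\bar1}=V_{\bar0}$, and $s:V\to sV$ is the odd linear map sending each element to the same element with opposite parity. A BiHom-Jordan superalgebra is a quadruple $(\mathfrak J,\cdot,\alpha,\beta)$ with $\mathfrak J$ a $\mathbb Z_2$-graded vector space, $\cdot$ an even bilinear product and $\alpha,\beta:\mathfrak J\to\mathfrak J$ two even commuting linear maps such that for all $x,y,z,t\in\mathcal H(\mathfrak J)$: $\beta(x)\cdot\alpha(y)=(-1)^{|x||y|}\beta(y)\cdot\alpha(x)$, and $$\circlearrowleft_{x,y,t}(-1)^{|t|(|x|+|z|)}ass_{\alpha,\beta}\big(\beta^2(x)\cdot\alpha\beta(y),\alpha^2\beta(z),\alpha^3(t)\big)=0,$$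 with cyclic sum over $(x,y,t)$ and $ass_{\alpha,\beta}(a,b,c)=(a\cdot b)\cdot\beta(c)-\alpha(a)\cdot(b\cdot c)$. It is multiplicative if $\alpha,\beta$ preserve the product and regular if they are superalgebra automorphisms. A representation of a regular multiplicative BiHom-Jordan superalgebra is a quadruple $(V,\rho,\alpha_V,\beta_V)$ with $V$ a $\mathbb Z_2$-graded vector space, $\rho:\mathfrak J\to\mathfrak{gl}(V)$ an even linear map, and $\alpha_V,\beta_V$ two even commuting linear automorphisms of $V$, such that for all $x,y,z\in\mathcal H(\mathfrak J)$ (with $\sum_{x,y,z}$ the cyclic sum over $(x,y,z)$): (R1) $\alpha_V\rho(x)=\rho(\alpha(x))\alpha_V$ and $\beta_V\rho(x)=\rho(\beta(x))\beta_V$; (R2) $\sum_{x,y,z}(-1)^{|x||z|}\rho\big(\alpha\beta^2(x)\cdot\alpha^2\beta(y)\big)\rho(\alpha^2\beta(z))\alpha_V^3=(-1)^{|x||z|}\rho\big((\beta^2(x)\cdot\alpha\beta(y))\cdot\alpha^2\beta(z)\big)\alpha_V^3\beta_V+(-1)^{|z|(|x|+|y|)}\rho(\alpha^2\beta^2(x))\rho(\alpha^2\beta(z))\rho(\alpha^2(y))\alpha_V^3\beta_V^{-1}+(-1)^{|x||y|}\rho(\alpha^2\beta^2(y))\rho(\alpha^2\beta(z))\rho(\alpha^2(x))\alpha_V^3\beta_V^{-1}$; (R3) $\sum_{x,y,z}(-1)^{|x||z|}\rho(\alpha^2\beta^2(x))\rho\big(\alpha\beta(y)\cdot\alpha^2(z)\big)\alpha_V^3=\sum_{x,y,z}(-1)^{|x||z|}\rho\big(\alpha\beta^2(x)\cdot\alpha^2\beta(y)\big)\rho(\alpha^2\beta(z))\alpha_V^3$.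 The parity reverse of $(V,\rho,\alpha_V,\beta_V)$ is the representation $(sV,\rho^s,\alpha_V^s,\beta_V^s)$ with $\alpha_V^s(su)=s(\alpha_V(u))$, $\beta_V^s(su)=s(\beta_V(u))$ and $\rho^s(x)su=(-1)^{|x|}s(\rho(x)u)$. A homogeneous linear map $T:V\to\mathfrak J$ is an $\mathcal O$-operator of $\mathfrak J$ associated to $\rho$ if $\alpha T=T\alpha_V$, $\beta T=T\beta_V$ and for all $u,v\in\mathcal H(V)$ $$T(u)\cdot T(v)=T\big((-1)^{|T|(|T|+|u|)}\rho(T(u))v+(-1)^{|u|(|v|+|T|)}\rho(T(\alpha_V^{-1}\beta_V(v)))\alpha_V\beta_V^{-1}(u)\big).$$ $\mathcal O_{\bar0}(\mathfrak J;V,\rho,\alpha_V,\beta_V)$ and $\mathcal O_{\bar1}(\mathfrak J;V,\rho,\alpha_V,\beta_V)$ denote the sets of even and odd $\mathcal O$-operators of $\mathfrak J$ associated to $(V,\rho,\alpha_V,\beta_V)$. *)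

(* Defs.v *)
From HB Require Import structures.
From mathcomp Require Import all_boot all_algebra.
From mathcomp Require Import boolp classical_sets functions.
Set Implicit Arguments.
Unset Strict Implicit.
Unset Printing Implicit Defensive.
Import GRing.Theory.
Local Open Scope ring_scope.

(* Parities live in the ring 'Z_2; in an exponent (-1) ^+ (a * (b + c)) the
   parity is computed in 'Z_2 and then coerced to nat (0 or 1). *)
Definition koszul (K : fieldType) (a : 'Z_2) : K := (-1) ^+ (a : nat).
Arguments koszul : clear implicits.

(* A direct sum decomposition V = V_0 (+) V_1. The projections are data, but
   they are determined by the two components. *)
Record superspace (K : fieldType) := Superspace {
  scarrier :> lmodType K;
  part : 'Z_2 -> {pred scarrier};
  hproj : 'Z_2 -> scarrier -> scarrier;
  part_submod : forall i, submod_closed (part i);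
  part_direct : forall v, v \in part 0 -> v \in part 1 -> v = 0;
  hproj_in : forall i v, hproj i v \in part i;
  hproj_sum : forall v, v = hproj 0 v + hproj 1 v }.

Arguments part {K} _ _ _.
Arguments hproj {K} _ _ _.

(* A homogeneous element with its parity (0 is homogeneous of both parities). *)
Record homog (K : fieldType) (V : superspace K) := Homog {
  hval :> V;
  par : 'Z_2;
  hvalP : hval \in part V par }.

Definition homogeneous_map (K : fieldType) (V W : superspace K) (i : 'Z_2)
    (f : V -> W) : Prop :=
  forall j v, v \in part V j -> f v \in part W (i + j).

Definition even_map (K : fieldType) (V W : superspace K) (f : V -> W) : Prop :=
  homogeneous_map 0 f.

Definition even_bilinear (K : fieldType) (U V W : superspace K)
    (f : U -> V -> W) : Prop :=
  forall i j u v, u \in part U i -> v \in part V j -> f u v \in part W (i + j).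

Definition cyclic_sum (T : Type) (W : zmodType) (F : T -> T -> T -> W)
    (x y z : T) : W := F x y z + F y z x + F z x y.

Section BihomJordanAxioms.
Variables (K : fieldType) (J : superspace K).
Variables (mul : J -> J -> J) (α β : J -> J).
Local Notation "x ∙ y" := (mul x y) (at level 40, left associativity).

Definition bihom_ass (a b c : J) : J := (a ∙ b) ∙ β c - α a ∙ (b ∙ c).

Definition bihom_supercommutative : Prop := forall x y : homog J,
  β x ∙ α y = koszul K (par x * par y) *: (β y ∙ α x).

Definition bihom_jordan_superidentity : Prop := forall x y z t : homog J,
  cyclic_sum (fun x y t : homog J =>
    koszul K (par t * (par x + par z)) *:
      bihom_ass (iter 2 β x ∙ α (β y)) (iter 2 α (β z)) (iter 3 α t))
    x y t = 0.

End BihomJordanAxioms.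

Record bihom_jordan (K : fieldType) := BihomJordan {
  bj_space :> superspace K;
  bj_mul : {bilinear bj_space -> bj_space -> bj_space};
  bj_alpha : {linear bj_space -> bj_space};
  bj_beta : {linear bj_space -> bj_space};
  bj_mul_even : even_bilinear bj_mul;
  bj_alpha_even : even_map bj_alpha;
  bj_beta_even : even_map bj_beta;
  bj_alpha_beta : forall x, bj_alpha (bj_beta x) = bj_beta (bj_alpha x);
  bj_supercomm : bihom_supercommutative bj_mul bj_alpha bj_beta;
  bj_jordan : bihom_jordan_superidentity bj_mul bj_alpha bj_beta }.

Definition multiplicative_map (K : fieldType) (J : bihom_jordan K)
    (f : J -> J) : Prop :=
  forall x y, f (bj_mul J x y) = bj_mul J (f x) (f y).

Definition bj_multiplicative (K : fieldType) (J : bihom_jordan K) : Prop :=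
  multiplicative_map (@bj_alpha K J) /\ multiplicative_map (@bj_beta K J).

Definition superalgebra_automorphism (K : fieldType) (J : bihom_jordan K)
    (f : {linear J -> J}) : Prop :=
  [/\ even_map f, multiplicative_map f & bijective f].

Definition bj_regular (K : fieldType) (J : bihom_jordan K) : Prop :=
  superalgebra_automorphism (bj_alpha J) /\
  superalgebra_automorphism (bj_beta J).

Section RepresentationAxioms.
Variables (K : fieldType) (J V : superspace K).
Variables (mul : J -> J -> J) (α β : J -> J).
Variables (rho : J -> V -> V) (alphaV betaV betaVi : V -> V).
Local Notation "x ∙ y" := (mul x y) (at level 40, left associativity).

(* Equalities of operators on V are stated pointwise. *)

Definition rep_R1 : Prop := forall (x : homog J) (v : V),
  alphaV (rho x v) = rho (α x) (alphaV v) /\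
  betaV (rho x v) = rho (β x) (betaV v).

Definition rep_R2 : Prop := forall (x y z : homog J) (v : V),
  cyclic_sum (fun x y z : homog J =>
    koszul K (par x * par z) *:
      rho (α (iter 2 β x) ∙ iter 2 α (β y))
        (rho (iter 2 α (β z)) (iter 3 alphaV v))) x y z
  = koszul K (par x * par z) *:
      rho ((iter 2 β x ∙ α (β y)) ∙ iter 2 α (β z)) (iter 3 alphaV (betaV v))
  + koszul K (par z * (par x + par y)) *:
      rho (iter 2 α (iter 2 β x)) (rho (iter 2 α (β z))
        (rho (iter 2 α y) (iter 3 alphaV (betaVi v))))
  + koszul K (par x * par y) *:
      rho (iter 2 α (iter 2 β y)) (rho (iter 2 α (β z))
        (rho (iter 2 α x) (iter 3 alphaV (betaVi v)))).

Definition rep_R3 : Prop := forall (x y z : homog J) (v : V),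
  cyclic_sum (fun x y z : homog J =>
    koszul K (par x * par z) *:
      rho (iter 2 α (iter 2 β x))
        (rho (α (β y) ∙ iter 2 α z) (iter 3 alphaV v))) x y z
  = cyclic_sum (fun x y z : homog J =>
    koszul K (par x * par z) *:
      rho (α (iter 2 β x) ∙ iter 2 α (β y))
        (rho (iter 2 α (β z)) (iter 3 alphaV v))) x y z.

End RepresentationAxioms.

(* rep_alphai and rep_betai are the inverses of the automorphisms. *)
Record representation (K : fieldType) (J : bihom_jordan K) := Representation {
  rep_space :> superspace K;
  rep_rho : {bilinear J -> rep_space -> rep_space};
  rep_alpha : {linear rep_space -> rep_space};
  rep_beta : {linear rep_space -> rep_space};
  rep_alphai : rep_space -> rep_space;
  rep_betai : rep_space -> rep_space;
  rep_rho_even : even_bilinear rep_rho;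
  rep_alpha_even : even_map rep_alpha;
  rep_beta_even : even_map rep_beta;
  rep_alpha_beta : forall v, rep_alpha (rep_beta v) = rep_beta (rep_alpha v);
  rep_alphaK : cancel rep_alpha rep_alphai;
  rep_alphaiK : cancel rep_alphai rep_alpha;
  rep_betaK : cancel rep_beta rep_betai;
  rep_betaiK : cancel rep_betai rep_beta;
  rep_R1P : rep_R1 (bj_alpha J) (bj_beta J) rep_rho rep_alpha rep_beta;
  rep_R2P :
    rep_R2 (bj_mul J) (bj_alpha J) (bj_beta J)
      rep_rho rep_alpha rep_beta rep_betai;
  rep_R3P :
    rep_R3 (bj_mul J) (bj_alpha J) (bj_beta J) rep_rho rep_alpha }.

Lemma part0 (K : fieldType) (V : superspace K) i : 0 \in part V i.
Proof. by case: (part_submod V i). Qed.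

Lemma partZ (K : fieldType) (V : superspace K) i (a : K) (v : V) :
  v \in part V i -> a *: v \in part V i.
Proof.
by case: (part_submod V i) => h0 hl hv; rewrite -[_ *: _]addr0; apply: hl.
Qed.

Lemma partB (K : fieldType) (V : superspace K) i (u v : V) :
  u \in part V i -> v \in part V i -> u - v \in part V i.
Proof.
case: (part_submod V i) => h0 hl hu hv.
by rewrite addrC -scaleN1r; apply: hl.
Qed.

Lemma Z2_ind (P : 'Z_2 -> Prop) : P 0 -> P 1 -> forall i, P i.
Proof.
move=> P0 P1 [[|[|//]] h].
- by rewrite (_ : Ordinal h = 0) //; apply: val_inj.
- by rewrite (_ : Ordinal h = 1) //; apply: val_inj.
Qed.

Lemma Z2_11 : 1 + 1 = 0 :> 'Z_2.
Proof. exact: val_inj. Qed.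

Lemma decomp_unique (K : fieldType) (V : superspace K) (u0 u1 v0 v1 : V) :
  u0 \in part V 0 -> u1 \in part V 1 -> v0 \in part V 0 -> v1 \in part V 1 ->
  u0 + u1 = v0 + v1 -> u0 = v0 /\ u1 = v1.
Proof.
move=> hu0 hu1 hv0 hv1 e.
have e' : u0 - v0 = v1 - u1.
  by apply/eqP; rewrite subr_eq addrAC eq_sym subr_eq addrC e addrC.
have z : u0 - v0 = 0.
  by apply: (@part_direct _ V); [exact: partB | rewrite e'; exact: partB].
split; apply/eqP; rewrite -subr_eq0; first by rewrite z.
by rewrite -oppr_eq0 opprB -e' z.
Qed.

Lemma hproj_linear (K : fieldType) (V : superspace K) i :
  linear (hproj V i).
Proof.
move=> a u v.
have [_ l0] := part_submod V 0; have [_ l1] := part_submod V 1.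
have [h0 h1] := @decomp_unique _ V _ _ _ _ (hproj_in 0 (a *: u + v))
  (hproj_in 1 (a *: u + v))
  (l0 a _ _ (hproj_in 0 u) (hproj_in 0 v))
  (l1 a _ _ (hproj_in 1 u) (hproj_in 1 v))
  (etrans (esym (hproj_sum (a *: u + v)))
    (etrans (congr2 (fun s t => a *: s + t) (hproj_sum u) (hproj_sum v))
      (etrans (congr1 (+%R^~ _) (scalerDr a _ _)) (addrACA _ _ _ _)))).
by move: i; apply: Z2_ind.
Qed.

Lemma hproj_homog (K : fieldType) (V : superspace K) i j (v : V) :
  v \in part V i -> hproj V j v = if j == i then v else 0.
Proof.
move: i j; apply: Z2_ind; apply: Z2_ind => /= hv.
- by case: (@decomp_unique _ V _ _ _ _ (hproj_in 0 v) (hproj_in 1 v) hv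
    (part0 V 1)) => //; rewrite addr0 -hproj_sum.
- by case: (@decomp_unique _ V _ _ _ _ (hproj_in 0 v) (hproj_in 1 v) hv
    (part0 V 1)) => //; rewrite addr0 -hproj_sum.
- by case: (@decomp_unique _ V _ _ _ _ (hproj_in 0 v) (hproj_in 1 v)
    (part0 V 0) hv) => //; rewrite add0r -hproj_sum.
- by case: (@decomp_unique _ V _ _ _ _ (hproj_in 0 v) (hproj_in 1 v)
    (part0 V 0) hv) => //; rewrite add0r -hproj_sum.
Qed.

Section ParityReverseSpace.
Variables (K : fieldType) (V : superspace K).

Let srev_direct (v : V) : v \in part V (0 + 1) -> v \in part V (1 + 1) -> v = 0.
Proof.
rewrite add0r Z2_11.
by move=> h1 h0; apply: (@part_direct _ V).
Qed.

Let srev_sum (v : V) : v = hproj V (0 + 1) v + hproj V (1 + 1) v.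
Proof.
rewrite add0r Z2_11.
by rewrite addrC -hproj_sum.
Qed.

(* sV has the same underlying vector space as V, with (sV)_i = V_(i+1). *)
Definition srev : superspace K :=
  @Superspace K V (fun i => part V (i + 1)) (fun i => hproj V (i + 1))
    (fun i => part_submod V (i + 1)) srev_direct
    (fun i => @hproj_in K V (i + 1)) srev_sum.

Definition s_map (v : V) : srev := v.
Definition s_inv (w : srev) : V := w.

Lemma s_map_linear : linear s_map. Proof. by []. Qed.
Lemma s_inv_linear : linear s_inv. Proof. by []. Qed.

HB.instance Definition _ :=
  GRing.isLinear.Build K V srev *:%R s_map s_map_linear.
HB.instance Definition _ :=
  GRing.isLinear.Build K srev V *:%R s_inv s_inv_linear.

Lemma s_mapK : cancel s_map s_inv. Proof. by []. Qed.
Lemma s_invK : cancel s_inv s_map. Proof. by []. Qed.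

Lemma s_map_odd : homogeneous_map 1 s_map.
Proof.
move=> i v hv; rewrite /part /= -addrA addrCA.
by rewrite Z2_11 addr0.
Qed.

End ParityReverseSpace.

Lemma koszulD (K : fieldType) (a b : 'Z_2) :
  koszul K (a + b) = koszul K a * koszul K b.
Proof.
move: a b; apply: Z2_ind; apply: Z2_ind.
- by rewrite addr0 /koszul mulr1.
- by rewrite add0r /koszul mul1r.
- by rewrite addr0 /koszul mulr1.
- by rewrite Z2_11 /koszul /= expr0 expr1 mulrNN mulr1.
Qed.

Section ParityReverseRepresentation.
Variables (K : fieldType) (J : bihom_jordan K) (V : representation J).
Local Notation sV := (srev V).
Local Notation s := (@s_map K V).
Local Notation si := (@s_inv K V).
Local Notation ρ := (rep_rho V).
Local Notation sg := (koszul K).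

(* The bilinear extension of rho^s(x) (s u) = (-1)^|x| s(rho(x) u). *)
Definition srho (x : J) (w : sV) : sV :=
  \sum_(i : 'Z_2) sg i *: s (ρ (hproj J i x) (si w)).

Lemma srho_homog i (x : J) (u : V) :
  x \in part J i -> srho x (s u) = sg i *: s (ρ x u).
Proof.
move=> hx; rewrite /srho (bigD1 i) //= big1 => [|j /negPf ji].
  by rewrite addr0 (hproj_homog _ hx) eqxx.
by rewrite (hproj_homog _ hx) ji linear0l !linear0.
Qed.

Lemma srho_bilinear : bilinear_for *:%R *:%R srho.
Proof.
split=> [w|x] a u v; rewrite /srho /= scaler_sumr -big_split /=; apply: eq_bigr.
  by move=> i _; rewrite hproj_linear linearPl linearP.
by move=> i _; rewrite !linearP.
Qed.

HB.instance Definition _ :=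
  bilinear_isBilinear.Build K J sV sV *:%R *:%R srho srho_bilinear.

Lemma srhoZ a x w : srho x (a *: w) = a *: srho x w.
Proof. exact: linearZr_LR. Qed.

Definition salpha : {linear sV -> sV} := s \o rep_alpha V \o si.
Definition sbeta : {linear sV -> sV} := s \o rep_beta V \o si.
Definition salphai (w : sV) : sV := s (rep_alphai (si w)).
Definition sbetai (w : sV) : sV := s (rep_betai (si w)).

Lemma srho_even : even_bilinear srho.
Proof.
move=> i j x w hx hw; rewrite -[w]s_invK (srho_homog _ hx); apply: partZ.
by rewrite /srev /= -addrA; apply: rep_rho_even.
Qed.

Lemma salpha_even : even_map salpha.
Proof. by move=> i w hw; rewrite /srev /= -addrA; apply: rep_alpha_even. Qed.

Lemma sbeta_even : even_map sbeta.
Proof. by move=> i w hw; rewrite /srev /= -addrA; apply: rep_beta_even. Qed.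

Lemma iter_part (f : J -> J) i n (x : J) :
  even_map f -> x \in part J i -> iter n f x \in part J i.
Proof.
by move=> ef hx; elim: n => //= n; rewrite -{2}[i]add0r; apply: ef.
Qed.

Lemma srep_alpha_beta w : salpha (sbeta w) = sbeta (salpha w).
Proof. exact: rep_alpha_beta. Qed.

Lemma salphaK : cancel salpha salphai. Proof. exact: rep_alphaK. Qed.
Lemma salphaiK : cancel salphai salpha. Proof. exact: rep_alphaiK. Qed.
Lemma sbetaK : cancel sbeta sbetai. Proof. exact: rep_betaK. Qed.
Lemma sbetaiK : cancel sbetai sbeta. Proof. exact: rep_betaiK. Qed.

Lemma iter_salpha n (u : V) :
  iter n salpha (s u) = s (iter n (rep_alpha V) u).
Proof. by elim: n => //= n ->. Qed.

Let eα : even_map (bj_alpha J) := @bj_alpha_even K J.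
Let eβ : even_map (bj_beta J) := @bj_beta_even K J.

Let pα i (x : J) : x \in part J i -> bj_alpha J x \in part J i.
Proof. by move=> h; rewrite -[i]add0r; apply: eα. Qed.

Let pβ i (x : J) : x \in part J i -> bj_beta J x \in part J i.
Proof. by move=> h; rewrite -[i]add0r; apply: eβ. Qed.

Local Ltac hom := repeat first
  [ apply: bj_mul_even | apply: (iter_part _ eα) | apply: (iter_part _ eβ)
  | apply: pα | apply: pβ | apply: hvalP | assumption ].

Lemma srep_R1 : rep_R1 (bj_alpha J) (bj_beta J) srho salpha sbeta.
Proof.
move=> x w; have [e1 e2] := rep_R1P x (si w); have hx := hvalP x; split.
  have := srho_homog (si (salpha w)) (pα hx); rewrite s_invK => ->.
  have := srho_homog (si w) hx; rewrite s_invK => ->.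
  by rewrite linearZ /= -e1.
have := srho_homog (si (sbeta w)) (pβ hx); rewrite s_invK => ->.
have := srho_homog (si w) hx; rewrite s_invK => ->.
by rewrite linearZ /= -e2.
Qed.

(* Each summand of (R2) and (R3) for rho^s carries the sign
   (-1)^(|x|+|y|+|z|). *)
Lemma srho2 i j (x y : J) (u : V) : x \in part J i -> y \in part J j ->
  srho x (srho y (s u)) = sg (i + j) *: s (ρ x (ρ y u)).
Proof.
move=> hx hy; rewrite (srho_homog _ hy) srhoZ (srho_homog _ hx).
by rewrite scalerA -koszulD addrC.
Qed.

Lemma srho3 i j k (x y z : J) (u : V) :
  x \in part J i -> y \in part J j -> z \in part J k ->
  srho x (srho y (srho z (s u))) = sg (i + j + k) *: s (ρ x (ρ y (ρ z u))).
Proof.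
move=> hx hy hz; rewrite (srho_homog _ hz) !srhoZ (srho2 _ hx hy).
by rewrite scalerA -koszulD addrC.
Qed.

Let sgAC (a b : 'Z_2) (v : sV) : sg a *: (sg b *: v) = sg b *: (sg a *: v).
Proof. by rewrite !scalerA mulrC. Qed.

Let srhoL i j k (x y z : J) (u : V) :
  x \in part J i -> y \in part J j -> z \in part J k ->
  srho (bj_mul J (bj_alpha J (iter 2 (bj_beta J) x))
          (iter 2 (bj_alpha J) (bj_beta J y)))
    (srho (iter 2 (bj_alpha J) (bj_beta J z)) (s u))
  = sg (i + j + k) *:
      s (ρ (bj_mul J (bj_alpha J (iter 2 (bj_beta J) x))
              (iter 2 (bj_alpha J) (bj_beta J y)))
          (ρ (iter 2 (bj_alpha J) (bj_beta J z)) u)).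
Proof. by move=> hx hy hz; apply: srho2; hom. Qed.

Lemma srep_R2 :
  rep_R2 (bj_mul J) (bj_alpha J) (bj_beta J) srho salpha sbeta sbetai.
Proof.
move=> x y z w; have e := rep_R2P x y z (si w).
rewrite -[iter 3 salpha (sbeta w)]/(s (iter 3 (rep_alpha V) (rep_beta V (si w)))).
rewrite -[iter 3 salpha (sbetai w)]/(s (iter 3 (rep_alpha V) (rep_betai (si w)))).
have -> : iter 3 salpha w = s (iter 3 (rep_alpha V) (si w)) by [].
move: e; rewrite /cyclic_sum !(srhoL _ (hvalP _) (hvalP _) (hvalP _)) => e.
rewrite (srho_homog (i := par x + par y + par z)); last by hom.
rewrite (srho3 (i := par x) (j := par z) (k := par y)); try by hom.
rewrite (srho3 (i := par y) (j := par z) (k := par x)); try by hom.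
have -> : par y + par z + par x = par x + par y + par z.
  by rewrite addrC addrA.
have -> : par z + par x + par y = par x + par y + par z.
  by rewrite -addrA addrC.
have -> : par x + par z + par y = par x + par y + par z.
  by rewrite addrAC.
rewrite !(sgAC _ (par x + par y + par z)) -!scalerDr; congr (_ *: _).
exact: e.
Qed.

Lemma srep_R3 : rep_R3 (bj_mul J) (bj_alpha J) (bj_beta J) srho salpha.
Proof.
move=> x y z w; have e := rep_R3P x y z (si w).
have -> : iter 3 salpha w = s (iter 3 (rep_alpha V) (si w)) by [].
move: e; rewrite /cyclic_sum !(srhoL _ (hvalP _) (hvalP _) (hvalP _)) => e.
rewrite (srho2 (i := par x) (j := par y + par z)); try by hom.
rewrite (srho2 (i := par y) (j := par z + par x)); try by hom.
rewrite (srho2 (i := par z) (j := par x + par y)); try by hom.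
rewrite !addrA.
have -> : par y + par z + par x = par x + par y + par z.
  by rewrite addrC addrA.
have -> : par z + par x + par y = par x + par y + par z.
  by rewrite -addrA addrC.
rewrite !(sgAC _ (par x + par y + par z)) -!scalerDr; congr (_ *: _).
exact: e.
Qed.

Definition parity_reverse : representation J :=
  @Representation K J sV srho salpha sbeta salphai sbetai
    srho_even salpha_even sbeta_even srep_alpha_beta
    salphaK salphaiK sbetaK sbetaiK srep_R1 srep_R2 srep_R3.

End ParityReverseRepresentation.

Section OperatorIdentity.
Variables (K : fieldType) (J V : superspace K).
Variables (mul : J -> J -> J) (rho : J -> V -> V).
Variables (alphaV betaV alphaVi betaVi : V -> V).

Definition O_operator_identity (i : 'Z_2) (T : V -> J) : Prop :=
  forall u v : homog V,
    mul (T u) (T v) =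
    T (koszul K (i * (i + par u)) *: rho (T u) v +
       koszul K (par u * (par v + i)) *:
         rho (T (alphaVi (betaV v))) (alphaV (betaVi u))).

End OperatorIdentity.

Definition is_O_operator (K : fieldType) (J : bihom_jordan K)
    (V : representation J) (i : 'Z_2) (T : {linear V -> J}) : Prop :=
  [/\ homogeneous_map i T,
      forall v, bj_alpha J (T v) = T (rep_alpha V v),
      forall v, bj_beta J (T v) = T (rep_beta V v) &
      O_operator_identity (bj_mul J) (rep_rho V) (rep_alpha V) (rep_beta V)
        (@rep_alphai K J V) (@rep_betai K J V) i T].

Definition O_operators (K : fieldType) (J : bihom_jordan K)
    (V : representation J) (i : 'Z_2) : set {linear V -> J} :=
  [set T | is_O_operator i T]%classic.

Arguments O_operators {K J} V i _.

(* Main.v *)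
(* The bijection is [T |-> T \o s^-1]. Passing from [V] to [sV] shifts the
   parities of [T], [u] and [v] by 1; the resulting change of the two Koszul
   signs is compensated by the signs (-1)^(|T|+|u|) and (-1)^(|T|+|v|) with
   which [rho^s] differs from [rho] at [T u] and [T (alphaV^-1 (betaV v))]. *)
Require Import Defs.
From HB Require Import structures.
From mathcomp Require Import all_boot all_algebra.
From mathcomp Require Import boolp classical_sets functions.
Set Implicit Arguments.
Unset Strict Implicit.
Unset Printing Implicit Defensive.
Import GRing.Theory.
Local Open Scope ring_scope.

Lemma addrr_Z2 (i : 'Z_2) : i + i = 0.
Proof. by move: i; apply: Z2_ind; apply: val_inj. Qed.

Lemma addr1K_Z2 (i : 'Z_2) : i + 1 + 1 = i.
Proof. by rewrite -addrA Z2_11 addr0. Qed.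

(** Operators are compared as bundled maps: functional extensionality equates the functions, proof
    irrelevance the linearity proofs. *)
Lemma linear_ext (K : fieldType) (V W : lmodType K) (f g : {linear V -> W}) :
  f =1 g -> f = g.
Proof.
case: f g => f [[f1] [f2]] [g [[g1] [g2]]] /= /funext e.
move: f1 f2 g1 g2; rewrite e => f1 f2 g1 g2.
by rewrite (Prop_irrelevance f1 g1) (Prop_irrelevance f2 g2).
Qed.

(** Modulo 2 the shifts of [b] and [c] cancel, so the shift of [a] adds just [b + c] to the
    exponent; the second factor, the sign coming from [srho], removes it. *)
Lemma koszul_shift (K : fieldType) (a b c : 'Z_2) :
  koszul K ((a + 1) * (b + 1 + (c + 1))) * koszul K (b + c) =
  koszul K (a * (b + c)).
Proof.
by rewrite -koszulD addrACA Z2_11 addr0 mulrDl mul1r -addrA addrr_Z2 addr0.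
Qed.

(** The images under [f] of the components of [v] decompose [f v], and such a decomposition is
    unique. *)
Lemma hproj_even (K : fieldType) (V W : superspace K) (f : {linear V -> W})
    i v : even_map f -> hproj W i (f v) = f (hproj V i v).
Proof.
move=> fE; have fP j : f (hproj V j v) \in part W j.
  by rewrite -[j in part W j]add0r; apply/fE/hproj_in.
have [e0 e1] := decomp_unique (hproj_in 0 (f v)) (hproj_in 1 (f v)) (fP 0)
  (fP 1) (etrans (esym (hproj_sum _))
    (etrans (congr1 f (hproj_sum v)) (linearD _ _ _))).
by move: i; apply: Z2_ind.
Qed.

(** A representation carries [rep_alphai] and [rep_betai] as bare functions, so their evenness has
    to be derived. *)
Lemma even_map_inverse (K : fieldType) (V W : superspace K)
    (f : {linear V -> W}) (g : W -> V) :
  even_map f -> cancel f g -> cancel g f -> even_map g.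
Proof.
move=> fE fK gK i w wP; rewrite add0r.
have -> : g w = hproj V i (g w); last exact: hproj_in.
(* [f] sends the [i]-component of [g w] to that of [w], which is [w] itself. *)
by rewrite -[RHS]fK -hproj_even // gK (hproj_homog i wP) eqxx.
Qed.

Section ParityReverseOperator.
Variables (K : fieldType) (J : bihom_jordan K) (V : representation J).
Local Notation sV := (parity_reverse V).

Lemma part_s_map (i : 'Z_2) (v : V) :
  (s_map v \in part (srev V) (i + 1)) = (v \in part V i).
Proof. by rewrite {1}/part /= addr1K_Z2. Qed.

Lemma homogeneous_map_srev (i : 'Z_2) (T : V -> J) :
  homogeneous_map i T <-> homogeneous_map (i + 1) (T \o @s_inv K V).
Proof.
split=> hT j v hv.
  by rewrite -addrA [1 + j]addrC; apply: hT.
have -> : i + j = i + 1 + (j + 1) by rewrite addrACA Z2_11 addr0.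
by apply: (hT _ (s_map v)); rewrite part_s_map.
Qed.

Lemma O_operator_argument_srev (i p q : 'Z_2) (T : V -> J) (u v : V) :
  homogeneous_map i T -> u \in part V p -> v \in part V q ->
  koszul K ((i + 1) * (i + 1 + (p + 1))) *: srho (T u) (s_map v) +
  koszul K ((p + 1) * (q + 1 + (i + 1))) *:
    srho (T (rep_alphai (rep_beta V v)))
      (s_map (rep_alpha V (rep_betai u))) =
  s_map (koszul K (i * (i + p)) *: rep_rho V (T u) v +
    koszul K (p * (q + i)) *:
      rep_rho V (T (rep_alphai (rep_beta V v))) (rep_alpha V (rep_betai u))).
Proof.
move=> hT hu hv.
(* This fixes the parity [i + q] of the second operator value, hence the sign that [srho] produces
   there. *)
have hw : rep_alphai (rep_beta V v) \in part V q.
  rewrite -[q]add0r; apply: (even_map_inverse (@rep_alpha_even _ _ V)).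
  - exact: rep_alphaK.
  - exact: rep_alphaiK.
  - by rewrite -[q]add0r; apply: rep_beta_even.
rewrite (srho_homog _ (hT _ _ hu)) (srho_homog _ (hT _ _ hw)).
by rewrite !scalerA koszul_shift [i + q]addrC koszul_shift linearD !linearZ.
Qed.

(** [T'] is only pointwise the composite, so that the lemma also applies to an arbitrary operator on
    [sV]. *)
Lemma is_O_operator_srev (i : 'Z_2) (T : {linear V -> J})
    (T' : {linear sV -> J}) : T' =1 T \o @s_inv K V ->
  is_O_operator i T <-> is_O_operator (i + 1) T'.
Proof.
move=> eT.
have eT' : (T' : sV -> J) = T \o @s_inv K V by apply/funext.
rewrite /is_O_operator eT'; split=> -[hT Ta Tb Tm]; split.
- exact/homogeneous_map_srev.
- exact: Ta.
- exact: Tb.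
- move=> u v.
  (* Parity [par u] in [sV] means parity [par u + 1] in [V]; the next shift leads back to
     [par u]. *)
  have hu : s_inv u \in part V (par u + 1) := hvalP u.
  have hv : s_inv v \in part V (par v + 1) := hvalP v.
  have := O_operator_argument_srev hT hu hv; rewrite !addr1K_Z2 => e.
  rewrite [RHS](congr1 (T \o @s_inv K V) e).
  exact: (Tm (Homog hu) (Homog hv)).
- exact/homogeneous_map_srev.
- exact: Ta.
- exact: Tb.
- move=> u v.
  have hu : s_map u \in part (srev V) (par u + 1).
    by rewrite part_s_map hvalP.
  have hv : s_map v \in part (srev V) (par v + 1).
    by rewrite part_s_map hvalP.
  have e := O_operator_argument_srev (proj2 (homogeneous_map_srev i T) hT)
    (hvalP u) (hvalP v).
  rewrite -[RHS](congr1 (T \o @s_inv K V) e).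
  exact: (Tm (Homog hu) (Homog hv)).
Qed.

End ParityReverseOperator.

Theorem theorem4p8 (K : closedFieldType) (charK : [pchar K] =i pred0)
    (J : bihom_jordan K) (multJ : bj_multiplicative J) (regJ : bj_regular J)
    (V : representation J) (i : 'Z_2) :
  exists f : {linear V -> J} -> {linear parity_reverse V -> J},
    set_bij (O_operators V i) (O_operators (parity_reverse V) (i + 1)) f.
Proof.
pose f (T : {linear V -> J}) : {linear parity_reverse V -> J} :=
  T \o @s_inv K V.
pose g (T' : {linear parity_reverse V -> J}) : {linear V -> J} :=
  T' \o @s_map K V.
have eT (T' : {linear parity_reverse V -> J}) : T' =1 g T' \o @s_inv K V by [].
exists f; split.
- by move=> T; apply: (proj1 (is_O_operator_srev i _)).
(* [s_inv] is the identity on the common carrier, so [T1 v] and [f T1 v] are convertible. *)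
- by move=> T1 T2 _ _ e; apply: linear_ext => v; rewrite -[T1 v]/(f T1 v) e.
- move=> T' hT'; exists (g T'); last exact: linear_ext.
  exact: (proj2 (is_O_operator_srev i (eT T'))).
Qed.
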